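(* Let $\Lambda$ be an invertible antisymmetric real $n\times n$ matrix and $H:\mathbb{R}^n\to\mathbb{R}$ smooth. A Runge-Kutta method with the coefficients $a_{ij}$ and $b_i$ ($i,j=1,\dots,s$) applied to the differential-algebraic system $$p=-\tfrac12\Lambda q,\qquad \dot p=\tfrac12\Lambda\dot q-DH(q)$$ retains its classical order of convergence: if the method has classical order $r$, then it is convergent of order $r$ for this differential-algebraic system.
   Context: The Runge-Kutta method with time step $h$ applied to the differential-algebraic system is the one-step map $\tilde F_h:(q,p)\mapsto(\bar q,\bar p)$ defined by $$P^i=-\tfrac12\Lambda Q_i,\quad \dot P^i=\tfrac12\Lambda\dot Q_i-DH(Q_i),\quad Q_i=q+h\sum_{j=1}^s a_{ij}\dot Q_j,\quad P^i=p+h\sum_{j=1}^s a_{ij}\dot P^j\quad(i=1,\dots,s),$$ $$\bar q=q+h\sum_{j=1}^s b_j\dot Q_j,\qquad \bar p=p+h\sum_{j=1}^s b_j\dot P^j$$ (the dots in $\dot Q_i$, $\dot P^i$ are part of the names of the internal stages; $DH$ is the gradient of $H$). Let $N=\{(q,p): p=-\frac12\Lambda q\}$ and let $\tilde\varphi_t:N\to N$ be the flow of the system: $\tilde\varphi_t(q,-\frac12\Lambda q)=(\varphi_t(q),-\frac12\Lambda\varphi_t(q))$, where $\varphi_t$ is the flow of $\Lambda\dot q=DH(q)$. The method is convergent of order $r$ for the system if there exist an open set $U\subset N$ and constants $C>0$, $\bar h>0$, $\bar T>0$ such that $\|(\tilde F_h)^K(q,p)-\tilde\varphi_T(q,p)\|\le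 Ch^r$, where $h=T/K$ with $K$ a positive integer, for all $(q,p)\in U$, $h\le\bar h$, $T\le\bar T$. The classical order of a Runge-Kutta method is its order of convergence when applied to (non-stiff) ordinary differential equations. *)

(* Defs.v *)
From HB Require Import structures.
From mathcomp Require Import all_boot all_order all_algebra.
From mathcomp Require Import all_classical all_reals all_analysis.
Import Order.TTheory GRing.Theory Num.Theory.
Import numFieldNormedType.Exports.

Set Implicit Arguments.
Unset Strict Implicit.
Unset Printing Implicit Defensive.

Local Open Scope classical_set_scope.
Local Open Scope ring_scope.

Section Smooth.
Context {R : realType} {V W : normedModType R}.

Fixpoint Ck (k : nat) (f : V -> W) : Prop :=
  if k is k'.+1 then
    (forall x, differentiable f x) /\ forall v, Ck k' (fun x => 'D_v f x)
  else continuous f.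

Definition smooth (f : V -> W) : Prop := forall k, Ck k f.

End Smooth.

Definition grad {R : realType} {n : nat} (H : 'cV[R]_n -> R) (q : 'cV[R]_n) :
  'cV[R]_n := \col_i 'D_(delta_mx i 0) H q.

Section OneStepMaps.
Context {R : realType} {E : normedModType R}.

(* For small h > 0, implicit stage equations determine the new state only as
   long as the stages stay near the current state: nonlinear equations
   usually have further solutions whose stages run away as h -> 0.  In
   [step d h x y], d bounds the distance from the stages to the current state.
   The one-step map is therefore given near each point of N, uniformly for
   small h; elsewhere the total function F is arbitrary. *)
Definition one_step_map (N : set E) (step : R -> R -> E -> E -> Prop)
    (F : R -> E -> E) : Prop :=
  forall x0 : E, N x0 -> exists d hbar : R, [/\ 0 < d, 0 < hbar &
    \forall x \near x0, N x -> forall h, 0 < h <= hbar ->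
      forall y, step d h x y <-> y = F h x].

(* Likewise phi t x is only constrained for small t, locally uniformly in x. *)
Definition local_flow (field_eq : E -> E -> Prop) (phi : R -> E -> E) : Prop :=
  forall x0 : E, exists2 T0 : R, 0 < T0 & \forall x \near x0,
    phi 0 x = x /\
    forall t : R, `|t| < T0 -> exists2 v : E,
      is_derive (t : R^o) 1 (phi^~ x) v & field_eq (phi t x) v.

Definition convergent_of_order (N : set E) (F phi : R -> E -> E) (r : nat) :
    Prop :=
  exists (U : set E) (C hbar Tbar : R),
    [/\ U !=set0, exists2 O : set E, open O & U = N `&` O,
        [/\ 0 < C, 0 < hbar & 0 < Tbar] &
      forall (x : E) (T : R) (K : nat), U x -> 0 < T <= Tbar -> (0 < K)%N ->
        T / K%:R <= hbar ->
        `|iter K (F (T / K%:R)) x - phi T x| <= C * (T / K%:R) ^+ r].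

End OneStepMaps.

Section RungeKutta.
Context {R : realType} {s : nat}.
Variables (a : 'I_s -> 'I_s -> R) (b : 'I_s -> R).

Definition ode_step {m : nat} (f : 'cV[R]_m -> 'cV[R]_m) (d h : R)
    (q qbar : 'cV[R]_m) : Prop :=
  exists Q Q' : 'I_s -> 'cV[R]_m,
    [/\ forall i, Q' i = f (Q i),
        forall i, Q i = q + h *: \sum_j a i j *: Q' j,
        forall i, `|Q i - q| < d &
        qbar = q + h *: \sum_j b j *: Q' j].

Definition classical_order (r : nat) : Prop :=
  forall (m : nat) (f : 'cV[R]_m -> 'cV[R]_m) (F phi : R -> 'cV[R]_m -> 'cV[R]_m),
    smooth f ->
    one_step_map setT (ode_step f) F ->
    local_flow (fun q v => v = f q) phi ->
    convergent_of_order setT F phi r.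

Section DAE.
Context {n : nat}.
Variables (L : 'M[R]_n) (H : 'cV[R]_n -> R).

Definition constraint : set ('cV[R]_n * 'cV[R]_n) :=
  [set x | x.2 = - 2^-1 *: (L *m x.1)].

(* Q' and P' are the dotted stages.  For x on the constraint set and small h
   this determines xbar iff (b_j) lies in the row space of (a_ij), as it does
   when (a_ij) is invertible.  For n > 0 and other coefficients (explicit Euler,
   for one) no F satisfies [one_step_map constraint dae_step]. *)
Definition dae_step (d h : R) (x xbar : 'cV[R]_n * 'cV[R]_n) : Prop :=
  exists Q Q' P P' : 'I_s -> 'cV[R]_n,
    [/\ forall i, P i = - 2^-1 *: (L *m Q i) /\
                  P' i = 2^-1 *: (L *m Q' i) - grad H (Q i),
        forall i, Q i = x.1 + h *: \sum_j a i j *: Q' j /\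
                  P i = x.2 + h *: \sum_j a i j *: P' j,
        forall i, `|Q i - x.1| < d &
        xbar = (x.1 + h *: \sum_j b j *: Q' j,
                x.2 + h *: \sum_j b j *: P' j)].

(* The flow on the constraint set, given the flow phi of L q' = DH(q). *)
Definition dae_flow (phi : R -> 'cV[R]_n -> 'cV[R]_n) (t : R)
    (x : 'cV[R]_n * 'cV[R]_n) : 'cV[R]_n * 'cV[R]_n :=
  (phi t x.1, - 2^-1 *: (L *m phi t x.1)).

End DAE.
End RungeKutta.

(* Main.v *)
Require Import Defs.
From mathcomp Require Import all_boot all_order all_algebra.
From mathcomp Require Import all_classical all_reals all_analysis.
From mathcomp Require Import ring.
Import Order.TTheory GRing.Theory Num.Theory.
Import numFieldNormedType.Exports.

Set Implicit Arguments.
Unset Strict Implicit.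
Unset Printing Implicit Defensive.

Local Open Scope classical_set_scope.
Local Open Scope ring_scope.

(* With f q = L^-1 DH(q), a point of the constraint set and the stage equations
   give A (Q' - f(Q)) = 0.  Since the step is single valued, b lies in the row
   space of A, so also b (Q' - f(Q)) = 0: the step preserves the constraint set
   and its q-component is the Runge-Kutta step for q' = f q, whose order is the
   classical one.  The step is determined only near a given point, so the
   iterates have to be confined there.  For r = 0 the order estimate does
   not do this; the bound |qbar - q| <= h B, coming from compactness of balls,
   does, for small T. *)

(** * Norm bounds for matrices and boundedness on balls *)

Lemma mx_norm_leP (R : realType) m n (A : 'M[R]_(m, n)) (c : R) : 0 <= c ->
  (`|A| <= c) <-> (forall i j, `|A i j| <= c).
Proof.
move=> c0; rewrite [X in X <= _]/Num.norm /= mx_normrE; split=> [Ac i j|Ac].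
  by move/bigmax_leP: Ac => [_ /(_ (i, j)) /= ->].
by apply/bigmax_leP; split=> // -[i j] _; exact: Ac.
Qed.

Lemma mulmx_lipschitz (R : realType) m n p (A : 'M[R]_(m, n)) :
  exists2 c : R, 0 <= c & forall v : 'M[R]_(n, p), `|A *m v| <= c * `|v|.
Proof.
pose c i := \sum_j `|A i j|.
have c0 i : 0 <= c i by rewrite /c sumr_ge0.
exists (\sum_i c i); first by rewrite sumr_ge0.
move=> v; apply/mx_norm_leP; first by rewrite mulr_ge0// sumr_ge0.
move=> i k; rewrite mxE; apply: le_trans (ler_norm_sum _ _ _) _.
apply: (@le_trans _ _ (c i * `|v|)); last first.
  by rewrite ler_wpM2r// (bigD1 i)//= lerDl sumr_ge0.
rewrite mulr_suml ler_sum// => j _; rewrite normrM ler_wpM2l//.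
by move/mx_norm_leP: (lexx `|v|); exact.
Qed.

(** Closed balls of row vectors are compact. Transposition, continuous and isometric for the
    entrywise maximum norm, carries this over to columns. *)
Lemma continuous_ball_bounded (R : realType) m n
    (f : 'cV[R]_m -> 'cV[R]_n) (rho : R) :
  continuous f -> exists2 M : R, 0 <= M & forall q, `|q| <= rho -> `|f q| <= M.
Proof.
move=> fc.
have trc : continuous (fun v : 'rV[R]_m => v^T).
  move=> v A /nbhs_ballP[e e0 eA]; apply/nbhs_ballP; exists e => // w [_ vw].
  by apply: eA; split=> // i j; rewrite !mxE; exact: vw.
have rc : compact [set v : 'rV[R]_m | `|v| <= rho].
  apply: bounded_closed_compact.
    exists rho; split; first exact: num_real.
    by move=> x rx v /= /le_trans; apply; exact: ltW.
  apply: (@preimage_closed _ _ (fun v : 'rV[R]_m => `|v|) [set y | y <= rho]).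
    by move=> v _; exact: norm_continuous.
  exact: closed_le.
have /compact_bounded[M [_ fM]] :
    compact ((fun v : 'rV[R]_m => f v^T) @` [set v | `|v| <= rho]).
  apply: continuous_compact rc; apply: continuous_subspaceT => v.
  by apply: continuous_comp; [exact: trc|exact: fc].
(* Every real above [M] is a bound, but [M] itself may be negative. *)
exists (`|M| + 1); first by rewrite addr_ge0.
move=> q qrho; apply: fM; first by rewrite (le_lt_trans (ler_norm M))// ltrDl.
exists q^T; last by rewrite trmxK.
rewrite /=; apply/mx_norm_leP; first exact: le_trans qrho.
move=> i j; rewrite mxE; apply: le_trans qrho.
by move/mx_norm_leP: (lexx `|q|); exact.
Qed.

(** * Smoothness of the vector field *)

Lemma Ck_scalel (R : realType) (V W : normedModType R) k (g : V -> R) (w : W) :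
  Ck k g -> Ck k (fun x => g x *: w).
Proof.
elim: k g => [|k IH] g /=; first by move=> gc x; apply: cvgZr_tmp; exact: gc.
move=> [dg Cg]; split=> [x|v]; first exact: differentiableZl.
rewrite (_ : (fun x => _) = (fun x => 'D_v g x *: w)); first exact/IH/Cg.
apply/funext => x; rewrite !deriveE//; last exact: differentiableZl.
by rewrite diffZl.
Qed.

Lemma Ck_sum (R : realType) (V W : normedModType R) k p (f : 'I_p -> V -> W) :
  (forall i, Ck k (f i)) -> Ck k (fun x => \sum_i f i x).
Proof.
elim: k f => [|k IH] f /= fC.
  by move=> x; apply: cvg_big => [|i _]; [exact: add_continuous|exact: fC].
have -> : (fun x => \sum_i f i x) = \sum_i f i.
  by apply/funext => x; rewrite fct_sumE.
split=> [x|v]; first by apply: differentiable_sum => i; apply: (fC i).1.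
rewrite (_ : (fun x => _) = (fun x => \sum_i 'D_v (f i) x)).
  by apply: IH => i; exact: (fC i).2.
by apply/funext => x; rewrite derive_sum// => i; apply/diff_derivable/(fC i).1.
Qed.

(** The product is a sum of columns of [A] weighted by partial derivatives of [H], so class [k]
    follows from class [k.+1] of [H]. *)
Lemma smooth_mulmx_grad (R : realType) n (A : 'M[R]_n) (H : 'cV[R]_n -> R) :
  smooth H -> smooth (fun q => A *m grad H q).
Proof.
move=> Hs k.
rewrite (_ : (fun q => _) =
    (fun q => \sum_i 'D_(delta_mx i 0) H q *: col i A)).
  by apply: Ck_sum => i; apply: Ck_scalel; exact: (Hs k.+1).2.
apply/funext => q; apply/colP => i; rewrite mxE summxE.
by apply: eq_bigr => j _; rewrite !mxE mulrC.
Qed.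

(** * Reduction to a Runge-Kutta step *)

(* Otherwise a vector [w] with [A w = 0] and [b w != 0] moves the stage
   derivatives without affecting the stages, but it does move the new state. *)
Lemma dae_step_unique_row_space (R : realType) (n s : nat) (L : 'M[R]_n)
    (H : 'cV[R]_n -> R) (a : 'I_s -> 'I_s -> R) (b : 'I_s -> R) (d h : R)
    (x y : 'cV[R]_n * 'cV[R]_n) :
  (0 < n)%N -> 0 < h -> dae_step a b L H d h x y ->
  (forall z, dae_step a b L H d h x z -> z = y) ->
  exists c : 'I_s -> R, forall j, b j = \sum_i c i * a i j.
Proof.
move=> n0 h0 [Q [Q' [P [P' [P_eq Q_eq Qd y_eq]]]]] y_unique.
pose A := \matrix_(i, j) a i j; pose bv : 'rV_s := \row_j b j.
have [/submxP[D bD]|] := boolP (bv <= A)%MS.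
  exists (D 0) => j; move/rowP: bD => /(_ j); rewrite !mxE => ->.
  by apply: eq_bigr => i _; rewrite mxE.
(* A row outside the row space of [A] has a nonzero product with some column [k] of [cokermx A];
   that column is [w]. *)
rewrite submxE => /matrix0Pn[i0 [k]]; rewrite mxE => bw.
pose w j := cokermx A j k.
have aw i : \sum_j a i j * w j = 0.
  have := mulmx_coker A => /matrixP/(_ i k); rewrite !mxE => aw0.
  by rewrite -[RHS]aw0; apply: eq_bigr => j _; rewrite mxE.
pose e : 'cV[R]_n := delta_mx (Ordinal n0) 0.
have shiftE (g : 'I_s -> R) (V : 'I_s -> 'cV[R]_n) u :
    \sum_j g j *: (V j + w j *: u) =
    \sum_j g j *: V j + (\sum_j g j * w j) *: u.
  rewrite scaler_suml -big_split /=; apply: eq_bigr => j _.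
  by rewrite scalerDr scalerA.
(* Shifting [Q'] by [w j *: e] forces the shift of [P'] by half its image under [L]; both sum to
   zero against each row of [A]. *)
pose Q2 j : 'cV_n := Q' j + w j *: e.
pose P2 j : 'cV_n := P' j + w j *: (2^-1 *: (L *m e)).
have /y_unique/(congr1 fst) : dae_step a b L H d h x
    (x.1 + h *: \sum_j b j *: Q2 j, x.2 + h *: \sum_j b j *: P2 j).
  exists Q, Q2, P, P2; split=> // i.
    split; first exact: (P_eq i).1.
    rewrite /P2 (P_eq i).2 mulmxDr scalerDr -addrA [RHS]addrAC -addrA.
    by rewrite -scalemxAr scalerA [w i * _]mulrC -scalerA addrA.
  by rewrite !shiftE aw !scale0r !addr0; exact: Q_eq.
rewrite y_eq /= shiftE scalerDr => /addrI; rewrite -[RHS]addr0 => /addrI/eqP.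
rewrite scalerA scaler_eq0 mulf_eq0 gt_eqF//=.
case/orP => [/eqP bw0|/eqP/colP/(_ (Ordinal n0))]; last first.
  by rewrite !mxE !eqxx => /eqP; rewrite oner_eq0.
case/eqP: bw; rewrite -[RHS]bw0; apply: eq_bigr => j _.
by rewrite mxE.
Qed.

Definition constraint_lift (R : realType) (n : nat) (L : 'M[R]_n)
  (q : 'cV[R]_n) : 'cV[R]_n * 'cV[R]_n := (q, - 2^-1 *: (L *m q)).

(* On the constraint set the stage equations for [P] reduce to [A G = 0] with
   [G j = Q' j - invmx L *m grad H (Q j)], and then also [b G = 0]. *)
Lemma dae_step_ode_step (R : realType) (n s : nat) (L : 'M[R]_n)
    (H : 'cV[R]_n -> R) (a : 'I_s -> 'I_s -> R) (b c : 'I_s -> R) (d h : R)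
    (q : 'cV[R]_n) (y : 'cV[R]_n * 'cV[R]_n) :
  L \in unitmx -> 0 < h -> (forall j, b j = \sum_i c i * a i j) ->
  dae_step a b L H d h (constraint_lift L q) y <->
  ode_step a b (fun q => invmx L *m grad H q) d h q y.1 /\
    y = constraint_lift L y.1.
Proof.
move=> Lu h0 bE; set f := fun q => _.
(* Since [grad H] is [L *m f], each [P'] stage is [L *m (Q' - f Q)] minus half of [L *m Q']. *)
have sumP' (g : 'I_s -> R) (Q Q' : 'I_s -> 'cV[R]_n) :
    \sum_j g j *: (2^-1 *: (L *m Q' j) - grad H (Q j)) =
    L *m (\sum_j g j *: (Q' j - f (Q j))) -
    2^-1 *: (L *m \sum_j g j *: Q' j).
  rewrite !mulmx_sumr scaler_sumr -sumrB; apply: eq_bigr => j _.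
  rewrite -!scalemxAr scalerA [2^-1 * _]mulrC -scalerA -scalerBr.
  congr (_ *: _); rewrite mulmxBr /f mulmxA mulmxV// mul1mx addrAC; congr (_ - _).
  by rewrite -{2}[L *m Q' j]scale1r -scalerBl; congr (_ *: _); field.
split.
- case=> Q [Q' [P [P' [P_eq Q_eq Qd y_eq]]]]; rewrite /= in Q_eq Qd y_eq.
  have P'E (g : 'I_s -> R) : \sum_j g j *: P' j =
      L *m (\sum_j g j *: (Q' j - f (Q j))) - 2^-1 *: (L *m \sum_j g j *: Q' j).
    by rewrite -sumP'; apply: eq_bigr => j _; rewrite (P_eq j).2.
  (* The two expressions for [P i] agree up to [h] times [L] applied to this sum; [h] and [L] are
     invertible. *)
  have aG i : \sum_j a i j *: (Q' j - f (Q j)) = 0.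
    have := (Q_eq i).2; rewrite (P_eq i).1 (Q_eq i).1 P'E mulmxDr scalerDr.
    move/addrI; rewrite scalerBr -scalemxAr !scalerA mulNr [2^-1 * _]mulrC.
    rewrite scaleNr -[LHS]add0r => /addIr/esym/eqP.
    rewrite scaler_eq0 gt_eqF//= => /eqP/(congr1 (mulmx (invmx L))).
    by rewrite mulmxA mulVmx// mul1mx mulmx0.
  have bG : \sum_j b j *: (Q' j - f (Q j)) = 0.
    under eq_bigr do rewrite bE scaler_suml.
    rewrite exchange_big big1//= => i _.
    under eq_bigr do rewrite -scalerA.
    by rewrite -scaler_sumr aG scaler0.
  have subE (g : 'I_s -> R) : \sum_j g j *: (Q' j - f (Q j)) = 0 ->
      \sum_j g j *: Q' j = \sum_j g j *: f (Q j).
    move=> g0; apply/subr0_eq; rewrite -sumrB -[RHS]g0.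
    by apply: eq_bigr => j _; rewrite scalerBr.
  split.
    exists Q, (fun j => f (Q j)); split=> // [i|]; last by rewrite y_eq -subE.
    by rewrite -subE//; exact: (Q_eq i).1.
  rewrite y_eq /constraint_lift /=; congr (_, _).
  rewrite P'E bG mulmx0 sub0r mulmxDr scalerDr -scalemxAr scalerN !scalerA.
  by rewrite !mulNr !scaleNr [h * _]mulrC.
- case=> -[Q [Q' [Q'_eq Q_eq Qd y_eq]]] ->; rewrite y_eq.
  (* Now [Q' = f Q], so the defect term vanishes and every [P] increment is [- 2^-1 *: L] applied to
     the [Q] increment. *)
  have P'E (g : 'I_s -> R) :
      h *: \sum_j g j *: (2^-1 *: (L *m Q' j) - grad H (Q j)) =
      - 2^-1 *: (L *m (h *: \sum_j g j *: Q' j)).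
    rewrite sumP' [X in L *m X - _]big1 ?mulmx0 ?sub0r => [|j _].
      by rewrite -scalemxAr scalerN !scalerA mulNr scaleNr mulrC.
    by rewrite Q'_eq subrr scaler0.
  exists Q, Q', (fun i => - 2^-1 *: (L *m Q i)),
    (fun i => 2^-1 *: (L *m Q' i) - grad H (Q i)); split=> // [i|] /=.
    by rewrite P'E -scalerDr -mulmxDr -Q_eq.
  by rewrite /constraint_lift P'E -scalerDr -mulmxDr.
Qed.

(** * Estimates for confining and lifting the iterates *)

(** All stages lie within [d] of [q], hence in the ball of radius [d + rho], where [f] is bounded;
    so [B] is uniform in [h] and [q]. *)
Lemma ode_step_displacement (R : realType) (m s : nat)
    (a : 'I_s -> 'I_s -> R) (b : 'I_s -> R) (f : 'cV[R]_m -> 'cV[R]_m)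
    (d rho : R) :
  continuous f -> exists2 B : R, 0 <= B & forall h q y, `|q| <= rho -> 0 < h ->
    ode_step a b f d h q y -> `|y - q| <= h * B.
Proof.
move=> /(continuous_ball_bounded (d + rho))[M M0 fM].
exists (\sum_j `|b j| * M); first by apply: sumr_ge0 => j _; exact: mulr_ge0.
move=> h q y qrho h0 [Q [Q' [Q'_eq _ Qd ->]]].
rewrite addrAC subrr add0r normrZ gtr0_norm// ler_pM2l//.
apply: le_trans (ler_norm_sum _ _ _) _; apply: ler_sum => j _.
rewrite normrZ ler_wpM2l// Q'_eq fM// -(subrK q (Q j)).
by rewrite (le_trans (ler_normD _ _))// lerD// ltW.
Qed.

Lemma constraint_lift_lipschitz (R : realType) (n : nat) (L : 'M[R]_n) :
  exists2 c : R, 0 < c & forall p q,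
    `|constraint_lift L p - constraint_lift L q| <= c * `|p - q|.
Proof.
have [c c0 Lc] := @mulmx_lipschitz R n n 1 (- 2^-1 *: L).
exists (1 + c) => [|p q]; first by rewrite ltr_wpDr.
rewrite prod_normE /= ge_max mulrDl mul1r lerDl mulr_ge0//=.
rewrite -scalerBr -mulmxBr scalemxAl (le_trans (Lc _))//.
by rewrite lerDr.
Qed.

Lemma near_constraint_lift (R : realType) (n : nat) (L : 'M[R]_n) q
    (A : set ('cV[R]_n * 'cV[R]_n)) :
  nbhs (constraint_lift L q) A -> \forall p \near q, A (constraint_lift L p).
Proof.
have [c c0 Lc] := constraint_lift_lipschitz L.
move=> /nbhs_normP[e e0 eA].
apply/nbhs_ballP; exists (c^-1 * e) => /=; first by rewrite mulr_gt0// invr_gt0.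
move=> p; rewrite -ball_normE /= => qp; apply: eA.
apply: le_lt_trans (Lc _ _) _.
by rewrite -ltr_pdivlMl.
Qed.

Lemma constraint_liftP (R : realType) (n : nat) (L : 'M[R]_n) x :
  constraint L x <-> x = constraint_lift L x.1.
Proof.
by case: x => q p; rewrite /constraint /constraint_lift /=; split=> [->|[]].
Qed.

Theorem theorem4p6 (R : realType) (n s r : nat)
    (L : 'M[R]_n) (H : 'cV[R]_n -> R)
    (a : 'I_s -> 'I_s -> R) (b : 'I_s -> R)
    (F : R -> 'cV[R]_n * 'cV[R]_n -> 'cV[R]_n * 'cV[R]_n)
    (phi : R -> 'cV[R]_n -> 'cV[R]_n) :
  L \in unitmx -> L^T = - L -> smooth H ->
  one_step_map (constraint L) (dae_step a b L H) F ->
  local_flow (fun q v => L *m v = grad H q) phi ->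
  classical_order a b r ->
  convergent_of_order (constraint L) F (dae_flow L phi) r.
Proof.
move=> Lu _ Hs Fstep Hphi ab_order.
(* For [n = 0] the row space argument has no nonzero vector to shift by, but all points coincide. *)
have [n0|n_gt0] := posnP n.
  have eqx (x y : 'cV[R]_n * 'cV[R]_n) : x = y.
    case: x y => [x1 x2] [y1 y2].
    by congr (_, _); apply/colP => -[i i_n]; exfalso; move: i_n; rewrite n0.
  exists (constraint L), 1, 1, 1; split=> //.
  - by exists (constraint_lift L 0); exact/constraint_liftP.
  - by exists setT; [exact: openT|rewrite setIT].
  - move=> x T K _ /andP[T0 _] K0 _; rewrite [X in X - _](eqx _ 0).
    rewrite [X in _ - X](eqx _ 0) subrr normr0 mul1r exprn_ge0//.
    by rewrite divr_ge0// ltW.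
have lift_constr q : constraint L (constraint_lift L q).
  exact/constraint_liftP.
pose f q := invmx L *m grad H q.
have fs : smooth f by exact: smooth_mulmx_grad.
(* One point and one admissible step size suffice: the step from the lift of [0] with [h = hb]
   exists and is unique. *)
have [c bE] : exists c : 'I_s -> R, forall j, b j = \sum_i c i * a i j.
  have [d [hb [d0 hb0 /nbhs_singleton near0]]] := Fstep _ (lift_constr 0).
  have {}near0 := near0 (lift_constr 0) hb.
  rewrite hb0 lexx in near0; have {}near0 := near0 isT.
  apply: (@dae_step_unique_row_space _ n s L H a b d hb) => //.
    exact/near0.
  by move=> z /near0.
pose G h q := (F h (constraint_lift L q)).1.
have Gstep : one_step_map setT (ode_step a b f) G.
  move=> q0 _; have [d [hb [d0 hb0 nearF]]] := Fstep _ (lift_constr q0).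
  exists d, hb; split=> //.
  have := near_constraint_lift nearF.
  apply: filterS => q nearq _ h /[dup] hh /andP[h0 _] y.
  have {}nearq z := nearq (lift_constr q) h hh z.
  split=> [qy|->].
    rewrite /G; suff -> : F h (constraint_lift L q) = constraint_lift L y by [].
    by apply/esym/nearq/(dae_step_ode_step H d _ _ Lu h0 bE).
  by have /(dae_step_ode_step H d _ _ Lu h0 bE)[] := (nearq _).2 erefl.
have fflow : local_flow (fun q v => v = f q) phi.
  move=> q0; have [T0 T00 nearphi] := Hphi q0; exists T0 => //.
  apply: filterS nearphi => q [phi0 dphi]; split=> // t /dphi[v dv Lv].
  by exists v => //; rewrite /f -Lv mulmxA mulVmx// mul1mx.
have [U [C [hb [Tb [U0 [V V_open UV] [C0 hb0 Tb0] conv]]]]] :=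
  ab_order n f G phi fs Gstep fflow.
have [q0 Vq0 {}conv] : exists2 q0, V q0 & forall q T K, V q ->
    0 < T <= Tb -> (0 < K)%N -> T / K%:R <= hb ->
    `|iter K (G (T / K%:R)) q - phi T q| <= C * (T / K%:R) ^+ r.
  case: U0 => q0; rewrite {1}UV => -[_ Vq0]; exists q0 => // q T K Vq.
  by apply: conv; rewrite UV.
have [d [hb' [d0 hb'0 nearF]]] := Fstep _ (lift_constr q0).
have : \forall q \near q0, V q /\ forall h, 0 < h <= hb' -> forall y,
    dae_step a b L H d h (constraint_lift L q) y <->
    y = F h (constraint_lift L q).
  have nearV : nbhs q0 V by exact: open_nbhs_nbhs.
  have := near_constraint_lift nearF.
  by apply: filterS2 nearV => q Vq nearq; split=> // h hh; exact: nearq.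
case/nbhs_normP => e e0 near_e.
(* The radius covers all points within [e] of [q0]; [fs 0] is the continuity of [f]. *)
have [B B0 Bstep] := ode_step_displacement a b d (`|q0| + e) (fs 0).
have [cL cL0 cLip] := constraint_lift_lipschitz L.
(* Iterates start within [e / 2] of [q0] and drift by at most [T * B], which this bound keeps below
   [e / 2]; [B + 1] avoids dividing by zero. *)
pose Tb' := Num.min Tb (e / 2 / (B + 1)).
exists (constraint L `&` [set x | ball q0 (e / 2) x.1]), (cL * C),
  (Num.min hb hb'), Tb'.
split.
- exists (constraint_lift L q0); split; first exact: lift_constr.
  by apply: ballxx; rewrite divr_gt0.
- exists [set x | ball q0 (e / 2) x.1] => //.
  apply: (@open_comp _ _ fst (ball q0 (e / 2))); last exact: ball_open.
  by move=> x _; exact: cvg_fst.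
- split; [exact: mulr_gt0|by rewrite lt_min hb0|rewrite lt_min Tb0].
  by rewrite !divr_gt0// ltr_wpDl.
move=> x T K [/constraint_liftP xE]; rewrite -ball_normE /= => x_near.
rewrite le_min => /andP[T0 /andP[TTb TB]] K0; rewrite le_min => /andP[Khb Khb'].
set h := T / K%:R in Khb Khb' *.
have h0 : 0 < h by rewrite divr_gt0// ltr0n.
(* The two claims need each other: the drift bound keeps the iterate where [F] is determined, and
   there the next step is a lifted Runge-Kutta step, which bounds the next drift. *)
have iterE j : (j <= K)%N ->
    iter j (F h) x = constraint_lift L (iter j (G h) x.1) /\
    `|iter j (G h) x.1 - x.1| <= j%:R * (h * B).
  elim: j => [_|j IH jK]; first by rewrite /= -xE subrr normr0 mul0r.
  have [Fj Gj] := IH (ltnW jK).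
  rewrite !iterS Fj; set q := iter j (G h) x.1 in Fj Gj *.
  have q_near : `|q0 - q| < e.
    rewrite -(subrKA x.1) (splitr e); apply: le_lt_trans (ler_normD _ _) _.
    rewrite ltr_leD// distrC; apply: le_trans Gj _.
    rewrite mulrA; apply: (@le_trans _ _ (T * B)).
      rewrite ler_wpM2r// /h mulrCA ger_pMr// ler_pdivrMr ?ltr0n// mul1r.
      by rewrite ler_nat ltnW.
    move: TB; rewrite ler_pdivlMr ?ltr_wpDl//; apply: le_trans.
    by rewrite ler_pM2l// lerDl.
  have [_ stepF] := near_e _ q_near.
  have hh : 0 < h <= hb' by rewrite h0.
  have /(dae_step_ode_step H d _ _ Lu h0 bE)[Gq FE] := (stepF h hh _).2 erefl.
  split; first exact: FE.
  rewrite -(subrKA q) -natr1 mulrDl mul1r addrC.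
  apply: le_trans (ler_normD _ _) _.
  rewrite lerD//; apply: Bstep Gq => //.
  rewrite -(subrK q0 q) (le_trans (ler_normD _ _))// addrC lerD2l distrC.
  exact: ltW.
have [-> _] := iterE K (leqnn K).
(* Both points are lifts, [dae_flow] by definition, so the error is at most [cL] times the error in
   [q]. *)
apply: le_trans (cLip _ _) _; rewrite -mulrA ler_pM2l//.
apply: conv => //; last by rewrite T0.
apply: (near_e _ _).1; rewrite /=; apply: lt_trans x_near _.
by rewrite ltr_pdivrMr// ltr_pMr// ltr1n.
Qed.
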